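(* Let $c>0$ and let $(\beta_n)$ be a sequence in $[0,1)$ with $\lim_{n\to\infty}\beta_n=0$, and consider $\mathcal{D}_{n,c}^{*\beta_n}$ for $n>3c$. Then for every compact set $B\subset\mathbb{R}^+$ and every $f\in C_{\rho_0}(\mathbb{R}^+)$, $$\lim_{n\to\infty}\mathcal{D}_{n,c}^{*\beta_n}(f,x)=f(x)\quad\text{uniformly in } x\in B.$$
   Context: For $\beta\in[0,1)$, $y\ge 0$, $n\in\mathbb{N}$ and integers $v\ge0$ let $\omega_\beta(v,ny)=ny(ny+v\beta)^{v-1}\frac{e^{-(ny+v\beta)}}{v!}$. For $c>0$, integers $v\ge1$ and $t\ge0$ let $p_{n,v-1,c}(t)=c\,\frac{\Gamma(n/c+v-1)}{\Gamma(v)\Gamma(n/c)}\cdot\frac{(ct)^{v-1}}{(1+ct)^{n/c+v-1}}$. For $n>2c$ put $r_n(x)=\frac{(n-2c)(1-\beta)x}{n}$ and define the King-type operators $$\mathcal{D}_{n,c}^{*\beta}(f,x)=\frac{n-c}{c}\sum_{v=1}^{\infty}\omega_\beta(v,n r_n(x))\int_0^\infty p_{n,v-1,c}(t)f(t)\,dt+e^{-n r_n(x)}f(0),\quad x\ge0$$ (with $\beta=\beta_n$ in $r_n$ when $\beta=\beta_n$). With $\rho_0(x)=1+x^2$, $C_{\rho_0}(\mathbb{R}^+)$ is the set of continuous functions $f$ on $[0,\infty)$ with $|f(x)|\le M_f(1+x^2)$ for some constant $M_f$ and such that $f(x)/\rho_0(x)$ converges as $x\to\infty$. *)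

(* Defs.v *)
From Stdlib Require Import Reals.
From Coquelicot Require Import Coquelicot.
Open Scope R_scope.

Definition Gamma (s : R) : R :=
  RInt_gen (fun t => Rpower t (s - 1) * exp (- t))
           (at_right 0) (Rbar_locally p_infty).

Definition omega (beta : R) (v : nat) (z : R) : R :=
  z * (z + INR v * beta) ^ (v - 1) * exp (- (z + INR v * beta)) / INR (Factorial.fact v).

(* p_{n,v-1,c}(t) for v >= 1 (n real-valued via INR). *)
Definition p_kernel (n : nat) (c : R) (v : nat) (t : R) : R :=
  c * (Gamma (INR n / c + INR v - 1) / (Gamma (INR v) * Gamma (INR n / c)))
    * ((c * t) ^ (v - 1) / Rpower (1 + c * t) (INR n / c + INR v - 1)).

Definition r_n (n : nat) (c beta x : R) : R :=
  (INR n - 2 * c) * (1 - beta) * x / INR n.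

Definition Dstar (n : nat) (c beta : R) (f : R -> R) (x : R) : R :=
  (INR n - c) / c *
    Series (fun k : nat =>
      let v := S k in
      omega beta v (INR n * r_n n c beta x) *
      RInt_gen (fun t => p_kernel n c v t * f t)
               (at_point 0) (Rbar_locally p_infty))
  + exp (- (INR n * r_n n c beta x)) * f 0.

Definition C_rho0 (f : R -> R) : Prop :=
  (forall x, 0 <= x ->
     filterlim f (within (fun y => 0 <= y) (locally x)) (locally (f x))) /\
  (exists M, forall x, 0 <= x -> Rabs (f x) <= M * (1 + x ^ 2)) /\
  (exists l : R, is_lim (fun x => f x / (1 + x ^ 2)) p_infty l).

(* Main.v *)
(** The operators are positive, so a Korovkin argument applies: a continuous
    [f] of quadratic growth satisfies [|f t - f x| <= eps + C (t - x)^2] for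
    [x] in a compact set and [t >= 0], whence
    [|D f x - f x| <= eps + C D((. - x)^2) x].  The operator fixes [1] and [t],
    and [D((. - x)^2) x = (c x^2 + x (1 + 1/(1-b)^2)) / (n - 3c) -> 0].

    The moments of the kernels are Beta integrals with one integer parameter.
    Those of the weights follow from
    [sum_v (a+vb)^(v+m) e^-(a+vb) / v!] for [m = 0, 1]: expand the exponential
    and sum over the diagonals [v + k = N]; each diagonal is an [N]-th finite
    difference of a polynomial of degree [N + m].  The double series converges
    absolutely for [b <= 1/8], which suffices because [beta_n -> 0]. *)

Require Import Defs.
From Stdlib Require Import Reals Factorial Lra Lia.
From Coquelicot Require Import Coquelicot.
Open Scope R_scope.

(** * Abel's summation and the generalized Poisson weights *)

Lemma is_lim_seq_sum_f_R0 (a : nat -> nat -> R) (A : nat -> R) (V : nat) :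
  (forall v, is_lim_seq (fun M => a M v) (A v)) ->
  is_lim_seq (fun M => sum_f_R0 (a M) V) (sum_f_R0 A V).
Proof.
  intros H; induction V as [|V IH]; simpl; [apply H|].
  now apply is_lim_seq_plus'.
Qed.

Lemma series_tail_small (b : nat -> R) (eps : R) :
  ex_series b -> 0 < eps ->
  exists V, Rabs (Series (fun k => b (S V + k)%nat)) < eps.
Proof.
  intros Hb Heps.
  pose proof (Series_correct _ Hb) as Hs.
  assert (Hl : is_lim_seq (sum_n b) (Series b)) by exact Hs.
  apply is_lim_seq_spec in Hl.
  destruct (Hl (mkposreal _ Heps)) as [V HV].
  exists V. specialize (HV V (le_n _)). simpl in HV.
  rewrite (Series_incr_n b (S V)) in HV by (lia || assumption).
  rewrite sum_n_Reals in HV. simpl pred in HV.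
  replace (Series (fun k => b (S V + k)%nat))
    with (- (sum_f_R0 b V - (sum_f_R0 b V + Series (fun k => b (S V + k)%nat)))) by ring.
  now rewrite Rabs_Ropp.
Qed.

(** Dominated convergence for series: the differences are at most [2 * b v], so a fixed tail is
    uniformly small, while the remaining finite sum tends to 0 term by term. *)
Lemma is_lim_seq_Series_dominated (a : nat -> nat -> R) (A b : nat -> R) :
  (forall v, is_lim_seq (fun M => a M v) (A v)) ->
  (forall M v, Rabs (a M v) <= b v) -> ex_series b ->
  is_lim_seq (fun M => Series (a M)) (Series A).
Proof.
  intros Hlim Hle Hb.
  assert (HA : forall v, Rabs (A v) <= b v).
  { intros v. apply (is_lim_seq_le (fun M => Rabs (a M v)) (fun _ => b v) (Rabs (A v)) (b v)).
    - intros M; apply Hle.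
    - exact (is_lim_seq_abs _ _ (Hlim v)).
    - apply is_lim_seq_const. }
  assert (EA : ex_series A) by (apply (ex_series_le A b); [exact HA|exact Hb]).
  assert (Ea : forall M, ex_series (a M))
    by (intros M; apply (ex_series_le (a M) b); [exact (Hle M)|exact Hb]).
  assert (Hd : forall M v, Rabs (a M v - A v) <= 2 * b v).
  { intros M v. specialize (Hle M v); specialize (HA v).
    unfold Rminus; eapply Rle_trans; [apply Rabs_triang|]. rewrite Rabs_Ropp. lra. }
  assert (E2 : ex_series (fun v => 2 * b v)) by (apply (ex_series_scal 2 b); exact Hb).
  assert (Ed : forall M, ex_series (fun v => Rabs (a M v - A v))).
  { intros M. apply (ex_series_le (fun v => Rabs (a M v - A v)) (fun v => 2 * b v)); [|exact E2].
    intros v. unfold norm; simpl; unfold abs; simpl. rewrite Rabs_Rabsolu. apply Hd. }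
  apply is_lim_seq_spec. intros eps.
  destruct (series_tail_small _ (eps / 2) E2) as [V HV].
  { destruct eps; simpl; lra. }
  assert (Hfin : is_lim_seq (fun M => sum_f_R0 (fun v => Rabs (a M v - A v)) V) 0).
  { replace 0 with (sum_f_R0 (fun _ => 0) V) by (clear; induction V; simpl; lra).
    apply (is_lim_seq_sum_f_R0 (fun M v => Rabs (a M v - A v))).
    intros v. replace 0 with (Rabs (A v - A v)) by (rewrite Rminus_diag; apply Rabs_R0).
    apply (is_lim_seq_abs (fun M => a M v - A v) (A v - A v)).
    apply is_lim_seq_minus'; [apply Hlim|apply is_lim_seq_const]. }
  apply is_lim_seq_spec in Hfin.
  assert (He : 0 < eps / 2) by (destruct eps; simpl; lra).
  destruct (Hfin (mkposreal _ He)) as [N HN].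
  exists N. intros M HM. specialize (HN M HM). simpl in HN.
  rewrite Rminus_0_r in HN.
  rewrite <- Series_minus by auto.
  eapply Rle_lt_trans; [apply Series_Rabs, Ed|].
  rewrite (Series_incr_n _ (S V)) by (lia || apply Ed). simpl pred.
  assert (Series (fun k => Rabs (a M (S V + k)%nat - A (S V + k)%nat))
    <= Series (fun k => 2 * b (S V + k)%nat)).
  { apply Series_le.
    - intros k; split; [apply Rabs_pos|apply Hd].
    - now apply (ex_series_incr_n (fun v => 2 * b v)). }
  apply Rabs_def2 in HV. apply Rabs_def2 in HN. lra.
Qed.

Lemma Series_finite_support (a : nat -> R) (M : nat) :
  (forall v, (M < v)%nat -> a v = 0) -> Series a = sum_f_R0 a M.
Proof.
  intros H. apply is_series_unique.
  apply (filterlim_ext_loc (fun _ => sum_f_R0 a M)).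
  - exists M. intros n Hn. rewrite sum_n_Reals.
    induction Hn as [|n Hn IH]; [reflexivity|].
    simpl. rewrite <- IH, (H (S n)) by lia. ring.
  - apply filterlim_const.
Qed.

(** Both sides sum over the triangle v + k <= M; passing from [M] to [S M] adds the diagonal v + k =
    M + 1 to each. *)
Lemma sum_triangle_diagonal (t : nat -> nat -> R) (M : nat) :
  sum_f_R0 (fun v => sum_f_R0 (t v) (M - v)) M =
  sum_f_R0 (fun N => sum_f_R0 (fun v => t v (N - v)%nat) N) M.
Proof.
  induction M as [|M IH]; [reflexivity|].
  rewrite (tech5 (fun N => sum_f_R0 (fun v => t v (N - v)%nat) N)), <- IH.
  rewrite (tech5 (fun v => sum_f_R0 (t v) (S M - v))).
  rewrite (tech5 (fun v => t v (S M - v)%nat)).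
  rewrite Nat.sub_diag, <- Rplus_assoc, <- sum_plus. f_equal.
  apply sum_eq. intros v Hv.
  now replace (S M - v)%nat with (S (M - v)) by lia.
Qed.

(** Partial sums over diagonals are sums of truncated rows, whose limit in [M] follows by dominated
    convergence. It is enough to bound the partial sums of each row. *)
Lemma is_series_diagonal (t : nat -> nat -> R) (A b : nat -> R) :
  (forall v, is_series (t v) (A v)) ->
  (forall v K, Rabs (sum_f_R0 (t v) K) <= b v) -> ex_series b ->
  is_series (fun N => sum_f_R0 (fun v => t v (N - v)%nat) N) (Series A).
Proof.
  intros Ht Hle Hb.
  (* Row [v] is cut at [M - v] and set to 0 for v > M, so [Series (a M)] is the finite sum over the
     triangle v + k <= M. *)
  set (a := fun M v => if (v <=? M)%nat then sum_f_R0 (t v) (M - v) else 0).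
  assert (H : is_lim_seq (fun M => Series (a M)) (Series A)).
  { apply (is_lim_seq_Series_dominated a A b); [| |exact Hb].
    - intros v. apply (is_lim_seq_incr_n _ v).
      apply (is_lim_seq_ext (sum_n (t v))); [|exact (Ht v)].
      intros M. unfold a. replace (v <=? M + v)%nat with true
        by (symmetry; apply Nat.leb_le; lia).
      rewrite sum_n_Reals. f_equal. lia.
    - intros M v. unfold a. destruct (v <=? M)%nat; [apply Hle|].
      rewrite Rabs_R0. eapply Rle_trans; [apply Rabs_pos|apply (Hle v 0%nat)]. }
  unfold is_series. change (is_lim_seq (sum_n (fun N => sum_f_R0 (fun v => t v (N - v)%nat) N)) (Series A)).
  eapply is_lim_seq_ext; [|exact H].
  intros M. simpl. rewrite (Series_finite_support (a M) M).
  - rewrite sum_n_Reals, <- sum_triangle_diagonal. apply sum_eq.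
    intros v Hv. unfold a. now apply Nat.leb_le in Hv; rewrite Hv.
  - intros v Hv. unfold a. apply Nat.leb_gt in Hv. now rewrite Hv.
Qed.

(* [1/N!] times the [N]-th finite difference of [v |-> (a + v b)^m] at [v = 0]. *)
Definition abel_sum (b : R) (m N : nat) (a : R) : R :=
  sum_f_R0 (fun v => (-1) ^ (N - v) / (INR (fact v) * INR (fact (N - v)))
                     * (a + INR v * b) ^ m) N.

(** Up to the factor (N + 1)!, this is the binomial expansion of (1 - 1)^(N + 1). *)
Lemma abel_sum_0_S (b : R) (N : nat) (a : R) : abel_sum b 0 (S N) a = 0.
Proof.
  pose proof (binomial 1 (-1) (S N)) as H.
  replace ((1 + -1) ^ S N) with 0 in H by (simpl; ring).
  apply Rmult_eq_reg_l with (INR (fact (S N))); [|apply INR_fact_neq_0].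
  rewrite Rmult_0_r, H. unfold abel_sum. rewrite scal_sum.
  apply sum_eq. intros v Hv. unfold Binomial.C. rewrite pow1, pow_O.
  field; split; apply INR_fact_neq_0.
Qed.

(** One factor a + v b is split off. In its part v b, the quotient v / v! lowers the index by one,
    which moves the base point from [a] to [a + b]. *)
Lemma abel_sum_S_S (b : R) (m N : nat) (a : R) :
  abel_sum b (S m) (S N) a = a * abel_sum b m (S N) a + b * abel_sum b m N (a + b).
Proof.
  unfold abel_sum at 1.
  set (g := fun v => (-1) ^ (S N - v) / (INR (fact v) * INR (fact (S N - v)))
                     * (a + INR v * b) ^ m).
  rewrite (sum_eq _ (fun v => g v * a + INR v * g v * b)).
  2:{ intros v _. unfold g. simpl. ring. }
  rewrite sum_plus, <- !scal_sum. apply f_equal2; [reflexivity|]. apply f_equal.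
  rewrite decomp_sum by lia. rewrite Rmult_0_l, Rplus_0_l. simpl pred.
  apply sum_eq. intros v Hv. unfold g.
  replace (S N - S v)%nat with (N - v)%nat by lia.
  replace (a + INR (S v) * b) with (a + b + INR v * b) by (rewrite S_INR; ring).
  rewrite fact_simpl, mult_INR. field.
  repeat split; try apply INR_fact_neq_0. now apply not_0_INR.
Qed.

Lemma abel_sum_N_0 (b : R) (m : nat) (a : R) : abel_sum b m 0 a = a ^ m.
Proof. unfold abel_sum. simpl. rewrite Rmult_0_l, Rplus_0_r. field. Qed.

Lemma abel_sum_lt (b : R) (m N : nat) (a : R) : (m < N)%nat -> abel_sum b m N a = 0.
Proof.
  revert N a; induction m as [|m IH]; intros [|N] a H; try lia.
  - apply abel_sum_0_S.
  - rewrite abel_sum_S_S, !IH by lia. ring.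
Qed.

Lemma abel_sum_diag (b : R) (N : nat) (a : R) : abel_sum b N N a = b ^ N.
Proof.
  revert a; induction N as [|N IH]; intros a; [now rewrite abel_sum_N_0|].
  rewrite abel_sum_S_S, IH, abel_sum_lt by lia. simpl. ring.
Qed.

(** The divided difference of x^(N + 1) at the nodes a, a + b, ..., a + N b is the sum of these
    nodes; b^N times that sum is the right side. *)
Lemma abel_sum_superdiag (b : R) (N : nat) (a : R) :
  abel_sum b (S N) N a = b ^ N * ((INR N + 1) * a + b * (INR N * (INR N + 1) / 2)).
Proof.
  revert a; induction N as [|N IH]; intros a.
  - rewrite abel_sum_N_0. simpl. field.
  - rewrite abel_sum_S_S, IH, abel_sum_diag, S_INR. simpl pow. field.
Qed.

(** * Jain sums with exponents v and v + 1 *)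

(** [omega] has exponent v - 1, but its factorial moments cancel factors of v!; after shifting the
    index only m = 0 and m = 1 remain. *)
Definition jain_term (b : R) (m : nat) (a : R) (v : nat) : R :=
  (a + INR v * b) ^ (v + m) / INR (fact v) * exp (- (a + INR v * b)).

Lemma is_series_exp (x : R) : is_series (fun k => x ^ k / INR (fact k)) (exp x).
Proof.
  pose proof (is_exp_Reals x) as H. apply is_pseries_R in H.
  eapply is_series_ext; [|exact H]. intros k; simpl. unfold Rdiv; ring.
Qed.

Lemma exp_monotone (x y : R) : x <= y -> exp x <= exp y.
Proof.
  intros [H|H]; [left; now apply exp_increasing|right; now f_equal].
Qed.

Lemma exp_term_le (x : R) (k : nat) : 0 <= x -> x ^ k / INR (fact k) <= exp x.
Proof.
  intros Hx. eapply Rle_trans; [|apply (exp_ge_taylor x k Hx)].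
  destruct k as [|k]; [simpl; lra|].
  rewrite tech5.
  assert (0 <= sum_f_R0 (fun k => x ^ k / INR (fact k)) k); [|lra].
  apply cond_pos_sum. intros j.
  apply Rdiv_le_0_compat; [now apply pow_le|apply INR_fact_lt_0].
Qed.

Lemma exp_pow_INR (x : R) (n : nat) : exp x ^ n = exp (INR n * x).
Proof.
  induction n as [|n IH]; [now rewrite Rmult_0_l, exp_0|].
  simpl pow. rewrite IH, <- exp_plus. f_equal. rewrite S_INR. ring.
Qed.

Section Jain.
Variables (b a : R) (m : nat).
Hypotheses (Hb0 : 0 <= b) (Hb : b <= 1 / 8) (Ha : 0 <= a) (Hm : (m <= 1)%nat).

Let x v := a + INR v * b.
Let bound v := exp (4 * a) * (exp (1 / 2) / 2) ^ v.

Lemma jain_arg_pos v : 0 <= x v.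
Proof. unfold x. pose proof (pos_INR v). nra. Qed.

(** The growing factor [exp (x v)] is used so that the bound also covers the absolute values in the
    expansion of [exp (- x v)]. The left side is at most 2^-v exp (4 x_v), and 4 v b <= v / 2
    because b <= 1/8. *)
Lemma jain_bound v : x v ^ (v + m) / INR (fact v) * exp (x v) <= bound v.
Proof.
  pose proof (jain_arg_pos v) as Hx.
  assert (H1 : x v ^ m <= exp (x v)).
  { assert (1 + x v <= exp (x v)) by apply exp_ineq1_le.
    destruct m as [|[|]]; simpl; try lia; lra. }
  (* The Taylor term of [exp] at [2 * x v] rather than [x v] supplies the factor 2^-v that makes the
     bound summable. *)
  assert (H2 : x v ^ v / INR (fact v) <= (1 / 2) ^ v * exp (2 * x v)).
  { pose proof (exp_term_le (2 * x v) v ltac:(lra)) as H.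
    rewrite Rpow_mult_distr in H.
    replace (x v ^ v / INR (fact v)) with ((1/2) ^ v * (2 ^ v * x v ^ v / INR (fact v))).
    - apply Rmult_le_compat_l; [apply pow_le; lra|exact H].
    - assert (E : (1/2)^v * 2 ^ v = 1)
        by (rewrite <- Rpow_mult_distr; replace (1/2*2) with 1 by field; apply pow1).
      unfold Rdiv. rewrite <- !Rmult_assoc. unfold Rdiv in E. rewrite E. ring. }
  assert (H3 : 0 <= x v ^ v / INR (fact v))
    by (apply Rdiv_le_0_compat; [now apply pow_le|apply INR_fact_lt_0]).
  assert (H4 : 0 <= x v ^ m) by now apply pow_le.
  pose proof (exp_pos (x v)) as He.
  apply Rle_trans with ((1 / 2) ^ v * exp (2 * x v) * (exp (x v) * exp (x v))).
  - rewrite pow_add.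
    replace (x v ^ v * x v ^ m / INR (fact v) * exp (x v))
      with (x v ^ v / INR (fact v) * (x v ^ m * exp (x v))) by (unfold Rdiv; ring).
    apply Rmult_le_compat; try assumption.
    + nra.
    + nra.
  - unfold bound.
    replace (exp (1 / 2) / 2) with (1 / 2 * exp (1 / 2)) by field.
    rewrite Rpow_mult_distr, exp_pow_INR.
    rewrite Rmult_assoc, <- !exp_plus.
    rewrite (Rmult_comm (exp (4 * a))), Rmult_assoc, <- exp_plus.
    apply Rmult_le_compat_l; [apply pow_le; lra|].
    apply exp_monotone. unfold x. pose proof (pos_INR v). nra.
Qed.

Lemma ex_series_jain_bound : ex_series bound.
Proof.
  apply (ex_series_scal (exp (4 * a)) (fun v => (exp (1 / 2) / 2) ^ v)), ex_series_geom.
  (* The ratio is sqrt(e) / 2; its square is at most 3/4, so it is below 1. *)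
  assert (H : exp (1/2) * exp (1/2) <= 3)
    by (rewrite <- exp_plus; replace (1/2+1/2) with 1 by field; apply exp_le_3).
  pose proof (exp_pos (1/2)). rewrite Rabs_pos_eq by lra. nra.
Qed.

Lemma jain_term_bound v : Rabs (jain_term b m a v) <= bound v.
Proof.
  pose proof (jain_arg_pos v) as Hx.
  assert (H0 : 0 <= x v ^ (v + m) / INR (fact v))
    by (apply Rdiv_le_0_compat; [now apply pow_le|apply INR_fact_lt_0]).
  unfold jain_term. fold (x v). rewrite Rabs_pos_eq.
  - eapply Rle_trans; [|apply jain_bound].
    apply Rmult_le_compat_l; [exact H0|apply exp_monotone; lra].
  - apply Rmult_le_pos; [exact H0|left; apply exp_pos].
Qed.

Lemma ex_series_jain : ex_series (jain_term b m a).
Proof.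
  exact (ex_series_le (jain_term b m a) bound jain_term_bound ex_series_jain_bound).
Qed.

(** Expanding [exp (- x v)] gives a double series in v and k. On the diagonal v + k = N the powers
    merge into (x_v)^(N + m) with sign (-1)^(N - v), the summand of [abel_sum]; [jain_bound]
    justifies the rearrangement. *)
Lemma is_series_abel_sum :
  is_series (fun N => abel_sum b (N + m) N a) (Series (jain_term b m a)).
Proof.
  set (t := fun v k => x v ^ (v + m) / INR (fact v) * ((- x v) ^ k / INR (fact k))).
  assert (H : is_series (fun N => sum_f_R0 (fun v => t v (N - v)%nat) N)
                        (Series (jain_term b m a))).
  { apply (is_series_diagonal t _ bound); [| |exact ex_series_jain_bound].
    - intros v. exact (is_series_scal_l (x v ^ (v + m) / INR (fact v)) _ _ (is_series_exp (- x v))).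
    - intros v K. pose proof (jain_arg_pos v) as Hx.
      assert (H0 : 0 <= x v ^ (v + m) / INR (fact v))
        by (apply Rdiv_le_0_compat; [now apply pow_le|apply INR_fact_lt_0]).
      eapply Rle_trans; [|apply jain_bound].
      eapply Rle_trans; [apply Rsum_abs|].
      apply Rle_trans with
        (x v ^ (v + m) / INR (fact v) * sum_f_R0 (fun k => x v ^ k / INR (fact k)) K).
      + rewrite scal_sum. right. apply sum_eq. intros k _. unfold t.
        rewrite Rabs_mult, (Rabs_pos_eq _ H0). unfold Rdiv at 2.
        rewrite Rabs_mult, <- RPow_abs, Rabs_Ropp, (Rabs_pos_eq _ Hx), Rabs_inv.
        rewrite (Rabs_pos_eq (INR (fact k))) by apply pos_INR.
        unfold Rdiv; ring.
      + apply Rmult_le_compat_l; [exact H0|]. now apply exp_ge_taylor. }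
  eapply is_series_ext; [|exact H].
  intros N. unfold abel_sum. simpl. apply sum_eq. intros v Hv. unfold t.
  fold (x v). replace (N + m)%nat with (v + m + (N - v))%nat by lia.
  rewrite (pow_add (x v) (v + m)).
  replace (- x v) with ((-1) * x v) by ring. rewrite Rpow_mult_distr.
  field. split; apply INR_fact_neq_0.
Qed.
End Jain.

(** The Cauchy square of the geometric series: each of the N + 1 products in degree N equals b^N. *)
Lemma is_series_succ_geom (b : R) :
  0 <= b < 1 -> is_series (fun N => (INR N + 1) * b ^ N) (/ (1 - b) * / (1 - b)).
Proof.
  intros Hb. assert (Ha : Rabs b < 1) by (rewrite Rabs_pos_eq; lra).
  assert (He : ex_series (fun n => Rabs (b ^ n))).
  { eapply ex_series_ext; [|apply (ex_series_geom b Ha)].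
    intros n. simpl. rewrite Rabs_pos_eq; [easy|apply pow_le; lra]. }
  eapply is_series_ext; [|apply (is_series_mult _ _ _ _
    (is_series_geom b Ha) (is_series_geom b Ha) He He)].
  intros N; simpl.
  rewrite (sum_eq _ (fun _ => b ^ N)).
  - rewrite sum_cte, S_INR. ring.
  - intros k Hk. rewrite <- pow_add. f_equal; lia.
Qed.

(** The Cauchy product of the preceding series with the geometric one yields triangular numbers one
    degree too low; the factor [b] and an index shift correct this. *)
Lemma is_series_triangular_geom (b : R) :
  0 <= b < 1 ->
  is_series (fun N => INR N * (INR N + 1) / 2 * b ^ N) (b * / (1 - b) ^ 3).
Proof.
  intros Hb. assert (Ha : Rabs b < 1) by (rewrite Rabs_pos_eq; lra).
  assert (He : ex_series (fun n => Rabs (b ^ n))).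
  { eapply ex_series_ext; [|apply (ex_series_geom b Ha)].
    intros n. simpl. rewrite Rabs_pos_eq; [easy|apply pow_le; lra]. }
  assert (He' : ex_series (fun n => Rabs ((INR n + 1) * b ^ n))).
  { eapply ex_series_ext; [|eexists; apply (is_series_succ_geom b Hb)].
    intros n. simpl. rewrite Rabs_pos_eq; [easy|].
    apply Rmult_le_pos; [pose proof (pos_INR n); lra|apply pow_le; lra]. }
  pose proof (is_series_mult _ _ _ _
    (is_series_succ_geom b Hb) (is_series_geom b Ha) He' He) as H.
  apply (is_series_scal_l b) in H.
  (* The term N = 0 vanishes, so the sum may start at N = 1. *)
  apply is_series_decr_1.
  match goal with |- is_series _ ?l =>
    replace l with (b * (/ (1 - b) * / (1 - b) * / (1 - b))) end.
  2:{ unfold plus, opp; simpl. field. lra. }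
  eapply is_series_ext; [|exact H].
  intros N. unfold scal; simpl; unfold mult; simpl.
  rewrite (sum_eq _ (fun k => (INR k + 1) * b ^ N)).
  - rewrite <- scal_sum.
    assert (E : sum_f_R0 (fun k => INR k + 1) N = (INR N + 1) * (INR N + 2) / 2).
    { clear. induction N as [|N IH]; [simpl; field|].
      rewrite tech5, IH, S_INR. field. }
    rewrite E. replace (match N with 0%nat => 1 | S _ => INR N + 1 end) with (INR N + 1)
      by (destruct N; simpl; ring). field.
  - intros k Hk. rewrite Rmult_assoc, <- pow_add. do 2 f_equal; lia.
Qed.

(** Each diagonal contributes b^N whatever the value of [a], which leaves a geometric series. *)
Lemma is_series_jain_0 (b a : R) :
  0 <= b -> b <= 1 / 8 -> 0 <= a -> is_series (jain_term b 0 a) (/ (1 - b)).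
Proof.
  intros Hb0 Hb Ha.
  replace (/ (1 - b)) with (Series (jain_term b 0 a)).
  { apply Series_correct, ex_series_jain; auto. }
  pose proof (is_series_abel_sum b a 0 Hb0 Hb Ha ltac:(lia)) as H.
  apply is_series_unique in H. rewrite <- H. apply is_series_unique.
  eapply is_series_ext; [|apply is_series_geom; rewrite Rabs_pos_eq; lra].
  intros N; simpl. now rewrite Nat.add_0_r, abel_sum_diag.
Qed.

(** The diagonals are affine in [a]; slope and constant part are summed by the two series above. *)
Lemma is_series_jain_1 (b a : R) :
  0 <= b -> b <= 1 / 8 -> 0 <= a ->
  is_series (jain_term b 1 a) (a / (1 - b) ^ 2 + b ^ 2 / (1 - b) ^ 3).
Proof.
  intros Hb0 Hb Ha.
  assert (Hb1 : 0 <= b < 1) by lra.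
  replace (a / (1 - b) ^ 2 + b ^ 2 / (1 - b) ^ 3) with (Series (jain_term b 1 a)).
  { apply Series_correct, ex_series_jain; auto. }
  pose proof (is_series_abel_sum b a 1 Hb0 Hb Ha ltac:(lia)) as H.
  apply is_series_unique in H. rewrite <- H. apply is_series_unique.
  replace (a / (1 - b) ^ 2 + b ^ 2 / (1 - b) ^ 3)
    with (plus (a * (/ (1 - b) * / (1 - b))) (b * (b * / (1 - b) ^ 3)))
    by (unfold plus; simpl; field; lra).
  eapply is_series_ext; [|exact (is_series_plus _ _ _ _
    (is_series_scal_l a _ _ (is_series_succ_geom b Hb1))
    (is_series_scal_l b _ _ (is_series_triangular_geom b Hb1)))].
  intros N. simpl. rewrite Nat.add_1_r, abel_sum_superdiag.
  unfold plus, scal; simpl; unfold mult; simpl. field.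
Qed.

(** * Factorial moments of the weights *)

Section OmegaMoments.
Variables (b z : R).
Hypotheses (Hb0 : 0 <= b) (Hb : b <= 1 / 8) (Hz : 0 <= z).

(** Writing z = (z + v b) - v b turns the weight into a difference of two Jain terms, the second
    with base [z + b] and index v - 1. The missing mass [exp (- z)] is the term v = 0, the weight of
    f(0) in the operator. *)
Lemma is_series_omega : is_series (fun k => omega b (S k) z) (1 - exp (- z)).
Proof.
  assert (H1 : is_series (fun k => jain_term b 0 z (S k)) (/ (1 - b) - exp (- z))).
  { apply is_series_incr_1.
    match goal with |- is_series _ ?l => replace l with (/ (1 - b)) end.
    - now apply is_series_jain_0.
    - unfold jain_term, plus; simpl. rewrite Rmult_0_l, Rplus_0_r. field. lra. }
  pose proof (is_series_scal_l b _ _ (is_series_jain_0 b (z + b) Hb0 Hb ltac:(lra))) as H2.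
  replace (1 - exp (- z)) with (minus (/ (1 - b) - exp (- z)) (b * / (1 - b)))
    by (unfold minus, plus, opp; simpl; field; lra).
  eapply is_series_ext; [|exact (is_series_minus _ _ _ _ H1 H2)].
  intros k. unfold minus, plus, opp, scal; simpl; unfold mult; simpl.
  unfold jain_term, omega. replace (S k - 1)%nat with k by lia.
  rewrite !Nat.add_0_r, fact_simpl, mult_INR, S_INR, <- (tech_pow_Rmult _ k).
  replace (z + b + INR k * b) with (z + (INR k + 1) * b) by ring.
  field. split; [apply INR_fact_neq_0|pose proof (pos_INR k); lra].
Qed.

(** The factor v cancels in v!, leaving [z] times the Jain sum with m = 0 and base [z + b]. *)
Lemma is_series_omega_1 :
  is_series (fun k => (INR k + 1) * omega b (S k) z) (z / (1 - b)).
Proof.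
  eapply is_series_ext;
    [|exact (is_series_scal_l z _ _ (is_series_jain_0 b (z + b) Hb0 Hb ltac:(lra)))].
  intros k. unfold scal; simpl; unfold mult; simpl.
  unfold jain_term, omega. replace (S k - 1)%nat with k by lia.
  rewrite Nat.add_0_r, fact_simpl, mult_INR, S_INR.
  replace (z + b + INR k * b) with (z + (INR k + 1) * b) by ring.
  field. split; [apply INR_fact_neq_0|pose proof (pos_INR k); lra].
Qed.

(** The factor v (v - 1) kills the term v = 1 and cancels twice in v!; what remains is the Jain sum
    with m = 1 and base [z + 2 * b]. *)
Lemma is_series_omega_2 :
  is_series (fun k => (INR k + 1) * INR k * omega b (S k) z)
            (z * ((z + 2 * b) / (1 - b) ^ 2 + b ^ 2 / (1 - b) ^ 3)).
Proof.
  apply is_series_decr_1.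
  match goal with |- is_series _ ?l => replace l
    with (z * ((z + 2 * b) / (1 - b) ^ 2 + b ^ 2 / (1 - b) ^ 3))
    by (unfold plus, opp; simpl; field; lra) end.
  eapply is_series_ext;
    [|exact (is_series_scal_l z _ _ (is_series_jain_1 b (z + 2 * b) Hb0 Hb ltac:(lra)))].
  intros k. change (z * jain_term b 1 (z + 2 * b) k
    = (INR (S k) + 1) * INR (S k) * omega b (S (S k)) z).
  unfold jain_term, omega.
  rewrite Nat.add_1_r, !fact_simpl, !mult_INR. change (S (S k) - 1)%nat with (S k).
  rewrite !S_INR.
  replace (z + 2 * b + INR k * b) with (z + (INR k + 1 + 1) * b) by ring.
  pose proof (pos_INR k). field. split; [apply INR_fact_neq_0|lra].
Qed.

Lemma omega_nonneg k : 0 <= omega b (S k) z.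
Proof.
  unfold omega. apply Rdiv_le_0_compat; [|apply INR_fact_lt_0].
  pose proof (pos_INR (S k)).
  apply Rmult_le_pos; [apply Rmult_le_pos; [exact Hz|apply pow_le; nra]|left; apply exp_pos].
Qed.
End OmegaMoments.

(** * Improper integrals and the Gamma function *)

(** Describes intervals of any shape, so that the open half-line for [at_right 0] and the closed one
    for [at_point 0] are treated alike. *)
Definition convex_set (D : R -> Prop) :=
  forall a b x, D a -> D b -> a <= x <= b -> D x.

Lemma convex_set_Rmin (D : R -> Prop) (a b x : R) :
  convex_set D -> D a -> D b -> Rmin a b <= x <= Rmax a b -> D x.
Proof.
  intros H Ha Hb. unfold Rmin, Rmax. destruct (Rle_dec a b); intros Hx.
  - now apply (H a b).
  - now apply (H b a).
Qed.

(** The fundamental theorem of calculus on each window [a, b], followed by passing to the limit at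
    both ends independently. *)
Lemma is_RInt_gen_antiderivative (Fa Fb : (R -> Prop) -> Prop) {FFa : Filter Fa}
  {FFb : Filter Fb} (D : R -> Prop) (F f : R -> R) (la lb : R) :
  convex_set D -> Fa D -> Fb D ->
  (forall x, D x -> is_derive F x (f x)) -> (forall x, D x -> continuous f x) ->
  filterlim F Fa (locally la) -> filterlim F Fb (locally lb) ->
  is_RInt_gen f Fa Fb (lb - la).
Proof.
  intros HD Da Db HF Hc Hla Hlb.
  apply (filterlimi_lim_ext_loc (fun ab => F (snd ab) - F (fst ab))).
  - exists D D; trivial. intros a b Ha Hb; simpl.
    apply (is_RInt_derive F f); intros x Hx; [apply HF|apply Hc];
      now apply (convex_set_Rmin D a b).
  - apply (filterlim_comp_2 (G := locally lb) (H := locally (- la))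
      (fun ab : R * R => F (snd ab)) (fun ab : R * R => - F (fst ab)) Rplus).
    + exact (filterlim_comp _ _ _ snd F _ Fb _ filterlim_snd Hlb).
    + exact (filterlim_comp _ _ _ fst (fun a => - F a) _ Fa _ filterlim_fst
        (filterlim_comp _ _ _ F Ropp _ _ _ Hla (filterlim_opp la))).
    + exact (filterlim_plus lb (- la)).
Qed.

(** The endpoints come in either order, hence the absolute value around the integral of [g]. *)
Lemma Rabs_RInt_le_dominated (f g : R -> R) (a b : R) :
  ex_RInt f a b -> ex_RInt g a b ->
  (forall x, Rmin a b <= x <= Rmax a b -> Rabs (f x) <= g x) ->
  Rabs (RInt f a b) <= Rabs (RInt g a b).
Proof.
  assert (H : forall a b, a <= b -> ex_RInt f a b -> ex_RInt g a b ->
    (forall x, a <= x <= b -> Rabs (f x) <= g x) -> Rabs (RInt f a b) <= Rabs (RInt g a b)).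
  { clear. intros a b Hab Hf Hg Hle.
    eapply Rle_trans; [|apply Rle_abs].
    apply (norm_RInt_le f g a b); auto; apply (RInt_correct (V := R_CompleteNormedModule)); auto. }
  intros Hf Hg Hle. unfold Rmin, Rmax in Hle. destruct (Rle_dec a b) as [h|h].
  - now apply H.
  - apply ex_RInt_swap in Hf. apply ex_RInt_swap in Hg.
    rewrite <- (opp_RInt_swap f), <- (opp_RInt_swap g) by assumption.
    unfold opp; simpl. rewrite !Rabs_Ropp. apply H; auto; lra.
Qed.

(** Cauchy criterion: integrals of [f] over two windows differ by its integrals over two end pieces,
    and these are bounded by those of [g]. *)
Lemma ex_RInt_gen_dominated (Fa Fb : (R -> Prop) -> Prop) {FFa : ProperFilter Fa}
  {FFb : ProperFilter Fb} (D : R -> Prop) (f g : R -> R) :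
  convex_set D -> Fa D -> Fb D ->
  (forall a b, D a -> D b -> ex_RInt f a b) ->
  (forall a b, D a -> D b -> ex_RInt g a b) ->
  (forall x, D x -> Rabs (f x) <= g x) ->
  ex_RInt_gen g Fa Fb -> ex_RInt_gen f Fa Fb.
Proof.
  intros HD Da Db Hf Hg Hle Hex.
  assert (Hprod : filter_prod Fa Fb (fun ab => D (fst ab) /\ D (snd ab)))
    by (exists D D; simpl; auto).
  (* The generalized integral is a limit of a relation, so the Cauchy criterion asks that the
     integral eventually exist and be unique. *)
  assert (Hwd : forall h : R -> R, (forall a b, D a -> D b -> ex_RInt h a b) ->
    filter_prod Fa Fb (fun ab => (exists y, is_RInt h (fst ab) (snd ab) y) /\
      forall y1 y2, is_RInt h (fst ab) (snd ab) y1 -> is_RInt h (fst ab) (snd ab) y2 -> y1 = y2)).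
  { intros h Hh. eapply filter_imp; [|exact Hprod]. intros [a b] [Ha Hb]; simpl in *.
    split; [now apply Hh|]. intros y1 y2 H1 H2.
    now rewrite <- (is_RInt_unique _ _ _ _ H1), <- (is_RInt_unique _ _ _ _ H2). }
  apply (filterlimi_locally_cauchy (U := R_CompleteSpace)); [exact (Hwd f Hf)|].
  intros eps.
  pose proof (proj2 (filterlimi_locally_cauchy (U := R_CompleteSpace) _ (Hwd g Hg)) Hex) as Hc.
  assert (He : 0 < eps / 2) by (destruct eps; simpl; lra).
  destruct (Hc (mkposreal _ He)) as [P [[Q R' HQ HR HP] HPc]].
  exists (fun ab => (Q (fst ab) /\ D (fst ab)) /\ (R' (snd ab) /\ D (snd ab))).
  split.
  { exists (fun a => Q a /\ D a) (fun b => R' b /\ D b); simpl; auto; now apply filter_and. }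
  intros [a b] [a' b'] [[Qa Daa] [Rb Dbb]] [[Qa' Daa'] [Rb' Dbb']] u' v' Hu Hv; simpl in *.
  (* Two windows with the same right end differ by the integral of [g] over the left piece alone. *)
  assert (Hga : Rabs (RInt g a a') < eps / 2).
  { pose proof (HPc (a, b) (a', b) (HP _ _ Qa Rb) (HP _ _ Qa' Rb)
      _ _ (RInt_correct (V := R_CompleteNormedModule) _ _ _ (Hg a b Daa Dbb)) (RInt_correct (V := R_CompleteNormedModule) _ _ _ (Hg a' b Daa' Dbb))) as H.
    unfold ball in H; simpl in H; unfold AbsRing_ball, abs, minus, plus, opp in H; simpl in H.
    rewrite <- (RInt_Chasles g a a' b) in H by auto.
    unfold plus in H; simpl in H. rewrite <- Rabs_Ropp.
    replace (- RInt g a a') with (RInt g a' b + - (RInt g a a' + RInt g a' b)) by ring.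
    exact H. }
  assert (Hgb : Rabs (RInt g b b') < eps / 2).
  { pose proof (HPc (a, b) (a, b') (HP _ _ Qa Rb) (HP _ _ Qa Rb')
      _ _ (RInt_correct (V := R_CompleteNormedModule) _ _ _ (Hg a b Daa Dbb)) (RInt_correct (V := R_CompleteNormedModule) _ _ _ (Hg a b' Daa Dbb'))) as H.
    unfold ball in H; simpl in H; unfold AbsRing_ball, abs, minus, plus, opp in H; simpl in H.
    rewrite <- (RInt_Chasles g a b b') in H by auto.
    unfold plus in H; simpl in H.
    replace (RInt g b b') with (RInt g a b + RInt g b b' + - RInt g a b) by ring.
    exact H. }
  assert (Hfa : Rabs (RInt f a a') <= Rabs (RInt g a a')).
  { apply Rabs_RInt_le_dominated; auto. intros x Hx. apply Hle.
    now apply (convex_set_Rmin D a a'). }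
  assert (Hfb : Rabs (RInt f b b') <= Rabs (RInt g b b')).
  { apply Rabs_RInt_le_dominated; auto. intros x Hx. apply Hle.
    now apply (convex_set_Rmin D b b'). }
  rewrite <- (is_RInt_unique _ _ _ _ Hu), <- (is_RInt_unique _ _ _ _ Hv).
  rewrite <- (RInt_Chasles f a a' b), <- (RInt_Chasles f a' b b') by auto.
  unfold ball; simpl; unfold AbsRing_ball, abs, minus, plus, opp; simpl.
  replace (RInt f a' b + RInt f b b' + - (RInt f a a' + RInt f a' b))
    with (RInt f b b' + - RInt f a a') by ring.
  eapply Rle_lt_trans; [apply Rabs_triang|]. rewrite Rabs_Ropp. lra.
Qed.

Lemma filterlim_exp_opp_scal (k : R) :
  0 < k -> filterlim (fun t => exp (- (k * t))) (Rbar_locally p_infty) (locally 0).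
Proof.
  intros Hk. eapply filterlim_comp; [|exact is_lim_exp_m].
  intros P [M HM]. exists (- M / k). intros x Hx. apply HM.
  apply (Rmult_lt_compat_l k) in Hx; [|exact Hk].
  replace (k * (- M / k)) with (- M) in Hx by (field; lra). lra.
Qed.

Lemma filterlim_Ropp_0 (F : (R -> Prop) -> Prop) (f : R -> R) :
  filterlim f F (locally 0) -> filterlim (fun t => - f t) F (locally 0).
Proof.
  intros H. apply (filterlim_comp _ _ _ f Ropp F (locally 0)); [exact H|].
  rewrite <- Ropp_0 at 2. exact (filterlim_opp 0).
Qed.

Lemma filterlim_Rmult_0 (F : (R -> Prop) -> Prop) (k : R) (f : R -> R) :
  filterlim f F (locally 0) -> filterlim (fun t => k * f t) F (locally 0).
Proof.
  intros H. apply (filterlim_comp _ _ _ f (Rmult k) F (locally 0)); [exact H|].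
  rewrite <- (Rmult_0_r k) at 2. exact (filterlim_scal_r k 0).
Qed.

(** * The Gamma function for arguments at least 1 *)

Definition gamma_integrand (s t : R) : R := Rpower t (s - 1) * exp (- t).

Lemma convex_set_pos : convex_set (fun x => 0 < x).
Proof. intros a b x; lra. Qed.

Lemma at_right_pos : at_right 0 (fun x => 0 < x).
Proof. exists (mkposreal 1 Rlt_0_1). auto. Qed.

Lemma p_infty_gt (M : R) : Rbar_locally p_infty (fun x => M < x).
Proof. now exists M. Qed.

Lemma continuous_gamma_integrand (s x : R) : 0 < x -> continuous (gamma_integrand s) x.
Proof.
  intros Hx. apply (ex_derive_continuous (gamma_integrand s)).
  unfold gamma_integrand, Rpower. auto_derive. exact Hx.
Qed.

Lemma gamma_integrand_pos (s t : R) : 0 < gamma_integrand s t.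
Proof. apply Rmult_lt_0_compat; apply exp_pos. Qed.

(** The tangent inequality ln u <= u - 1 at u = t / (2 s) shows that (s - 1) ln t uses up at most
    half of the decay exp (-t). *)
Lemma gamma_integrand_le (s : R) : 1 <= s ->
  exists C, 0 < C /\ forall t, 0 < t -> gamma_integrand s t <= C * exp (- (/ 2 * t)).
Proof.
  intros Hs. exists (exp ((s - 1) * (ln (2 * s) - 1))). split; [apply exp_pos|].
  intros t Ht. unfold gamma_integrand, Rpower. rewrite <- !exp_plus.
  apply exp_monotone.
  assert (H : ln t <= t / (2 * s) - 1 + ln (2 * s)).
  { assert (H0 : 0 < t / (2 * s)) by (apply Rdiv_lt_0_compat; lra).
    pose proof (exp_ineq1_le (ln (t / (2 * s)))) as H1.
    rewrite exp_ln in H1 by exact H0. unfold Rdiv in H1 at 1.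
    rewrite ln_mult, ln_Rinv in H1; try lra. apply Rinv_0_lt_compat; lra. }
  assert (H2 : (s - 1) * (t / (2 * s)) <= / 2 * t).
  { replace (/ 2 * t) with (s * (t / (2 * s))) by (field; lra).
    apply Rmult_le_compat_r; [|lra]. apply Rdiv_le_0_compat; lra. }
  apply (Rmult_le_compat_l (s - 1)) in H; [|lra]. lra.
Qed.

Lemma ex_RInt_gamma_integrand (s a b : R) : 0 < a -> 0 < b -> ex_RInt (gamma_integrand s) a b.
Proof.
  intros Ha Hb. apply (ex_RInt_continuous (gamma_integrand s)). intros x Hx.
  apply continuous_gamma_integrand.
  now apply (convex_set_Rmin (fun x => 0 < x) a b _ convex_set_pos).
Qed.

Lemma filterlim_at_right_0 (f : R -> R) :
  continuous f 0 -> filterlim f (at_right 0) (locally (f 0)).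
Proof. 
  intros H. apply (filterlim_filter_le_1 (F := locally 0)); [|exact H].
  apply filter_le_within. Qed.

(** [RInt_gen] is total, so convergence must be shown before [Gamma] can be computed with. For s >=
    1 one exponential dominates the integrand on the whole half-line. *)
Lemma is_RInt_gen_Gamma (s : R) : 1 <= s ->
  is_RInt_gen (gamma_integrand s) (at_right 0) (Rbar_locally p_infty) (Gamma s).
Proof.
  intros Hs. apply (RInt_gen_correct (V := R_CompleteNormedModule)).
  destruct (gamma_integrand_le s Hs) as [C [HC Hle]].
  apply (ex_RInt_gen_dominated _ _ (fun x => 0 < x) _ (fun t => C * exp (- (/ 2 * t))));
    [apply convex_set_pos|apply at_right_pos|apply p_infty_gt|apply ex_RInt_gamma_integrand| | |].
  - intros a b _ _. apply (ex_RInt_continuous (fun t => C * exp (- (/ 2 * t)))).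
    intros x _. apply (ex_derive_continuous (fun t => C * exp (- (/ 2 * t)))). auto_derive; auto.
  - intros x Hx. rewrite Rabs_pos_eq by (left; apply gamma_integrand_pos). now apply Hle.
  - eexists. apply (is_RInt_gen_antiderivative _ _ (fun x => 0 < x)
      (fun t => - 2 * C * exp (- (/ 2 * t))));
    [apply convex_set_pos|apply at_right_pos|apply p_infty_gt| | | |].
    + intros x _. auto_derive; [auto|field].
    + intros x _. apply (ex_derive_continuous (fun t => C * exp (- (/ 2 * t)))). auto_derive; auto.
    + apply (filterlim_at_right_0 (fun t => - 2 * C * exp (- (/ 2 * t)))).
      apply (ex_derive_continuous (fun t => -2 * C * exp (- (/ 2 * t)))). auto_derive; auto.
    + apply filterlim_Rmult_0, filterlim_exp_opp_scal; lra.
Qed.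

(** Integration by parts: the difference of the two integrands has the antiderivative -t^s exp (-t),
    which vanishes at both ends. *)
Lemma Gamma_succ (s : R) : 1 <= s -> Gamma (s + 1) = s * Gamma s.
Proof.
  intros Hs.
  assert (H1 := is_RInt_gen_Gamma (s + 1) ltac:(lra)).
  assert (H2 := is_RInt_gen_scal _ s _ (is_RInt_gen_Gamma s Hs)).
  assert (H3 := is_RInt_gen_minus _ _ _ _ H1 H2).
  assert (H4 : is_RInt_gen (fun y => minus (gamma_integrand (s + 1) y) (scal s (gamma_integrand s y)))
    (at_right 0) (Rbar_locally p_infty) (0 - 0)).
  { apply (is_RInt_gen_antiderivative _ _ (fun x => 0 < x)
      (fun t => - gamma_integrand (s + 1) t));
    [apply convex_set_pos|apply at_right_pos|apply p_infty_gt| | | |].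
    - intros x Hx. unfold gamma_integrand, Rpower.
      auto_derive; [exact Hx|]. unfold minus, plus, opp, scal; simpl; unfold mult; simpl.
      replace (s + 1 - 1) with s by ring.
      replace (exp (s * ln x)) with (x * exp ((s - 1) * ln x)); [field; lra|].
      rewrite <- (exp_ln x Hx) at 1. rewrite <- exp_plus. f_equal; ring.
    - intros x Hx. apply (continuous_minus (gamma_integrand (s + 1)));
        [now apply continuous_gamma_integrand|].
      apply (continuous_scal_r s (gamma_integrand s)). now apply continuous_gamma_integrand.
    - apply filterlim_Ropp_0.
      (* For 0 < t < 1 and s >= 1 one has t^s exp (-t) <= t. *)
      apply (filterlim_le_le (fun _ => 0) _ (fun t => t) 0).
      + exists (mkposreal 1 Rlt_0_1). intros t Ht Hpos.
        unfold ball in Ht; simpl in Ht; unfold AbsRing_ball, abs, minus, plus, opp in Ht; simpl in Ht.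
        split; [left; apply gamma_integrand_pos|].
        unfold gamma_integrand, Rpower. replace (s + 1 - 1) with s by ring.
        assert (Ht1 : t < 1) by (apply Rabs_def2 in Ht; lra).
        assert (Hln : ln t < 0) by (rewrite <- ln_1; apply ln_increasing; [exact Hpos|exact Ht1]).
        rewrite <- (exp_ln t Hpos) at 3. rewrite <- exp_plus. apply exp_monotone. nra.
      + apply filterlim_const.
      + apply (filterlim_at_right_0 (fun t => t)), continuous_id.
    - apply filterlim_Ropp_0.
      destruct (gamma_integrand_le (s + 1) ltac:(lra)) as [C [HC Hle]].
      apply (filterlim_le_le (fun _ => 0) _ (fun t => C * exp (- (/ 2 * t))) 0).
      + exists 0. intros t Ht. split; [left; apply gamma_integrand_pos|now apply Hle].
      + apply filterlim_const.
      + apply filterlim_Rmult_0, filterlim_exp_opp_scal; lra. }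
  apply (is_RInt_gen_unique (V := R_CompleteNormedModule)) in H3.
  apply (is_RInt_gen_unique (V := R_CompleteNormedModule)) in H4.
  pose proof (eq_trans (eq_sym H3) H4) as H5. clear H4; rename H5 into H4.
  unfold minus, plus, opp, scal in H4; simpl in H4; unfold mult in H4; simpl in H4.
  lra.
Qed.

Lemma Gamma_1 : Gamma 1 = 1.
Proof.
  unfold Gamma. apply (is_RInt_gen_unique (V := R_CompleteNormedModule)).
  refine (eq_ind (0 - - (1)) (is_RInt_gen _ _ _) _ 1 ltac:(ring)).
  apply (is_RInt_gen_antiderivative _ _ (fun x => 0 < x) (fun t => - exp (- t)));
    [apply convex_set_pos|apply at_right_pos|apply p_infty_gt| | | |].
  - intros x Hx. rewrite Rminus_diag, Rpower_O by exact Hx. auto_derive; [auto|ring].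
  - intros x Hx. apply (continuous_gamma_integrand 1 x Hx).
  - replace (- (1)) with (- exp (- 0)) by (rewrite Ropp_0, exp_0; ring).
    apply (filterlim_at_right_0 (fun t => - exp (- t))).
    apply (ex_derive_continuous (fun t => - exp (- t))). auto_derive; auto.
  - apply filterlim_Ropp_0.
    eapply filterlim_ext; [|apply (filterlim_exp_opp_scal 1); lra].
    intros t; simpl. now rewrite Rmult_1_l.
Qed.

(** Every window containing [1, 2] has integral at least that over [1, 2]. Taking this positive
    number as tolerance in the limit excludes a value <= 0. *)
Lemma Gamma_pos (s : R) : 1 <= s -> 0 < Gamma s.
Proof.
  intros Hs. pose proof (is_RInt_gen_Gamma s Hs) as H.
  assert (Hd : 0 < RInt (gamma_integrand s) 1 2).
  { apply RInt_gt_0; [lra| |].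
    - intros; apply gamma_integrand_pos.
    - intros; apply continuous_gamma_integrand; lra. }
  pose proof (proj1 (filterlimi_locally (U := R_UniformSpace) _ (Gamma s)) H) as H0.
  clear H; rename H0 into H.
  specialize (H (mkposreal _ Hd)). simpl in H.
  assert (H' : filter_prod (at_right 0) (Rbar_locally p_infty)
    (fun ab => 0 < fst ab < 1 /\ 2 < snd ab)).
  { exists (fun a => 0 < a < 1) (fun b => 2 < b); simpl; auto; [|apply p_infty_gt].
    exists (mkposreal 1 Rlt_0_1). intros t Ht Hpos.
    unfold ball in Ht; simpl in Ht; unfold AbsRing_ball, abs, minus, plus, opp in Ht; simpl in Ht.
    apply Rabs_def2 in Ht. lra. }
  destruct (filter_ex _ (filter_and _ _ H H')) as [[a b] [[y [Hy Hball]] [Ha Hb]]]; simpl in *.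
  unfold ball in Hball; simpl in Hball; unfold AbsRing_ball, abs, minus, plus, opp in Hball; simpl in Hball.
  apply (is_RInt_unique (V := R_CompleteNormedModule)) in Hy.
  rewrite <- (RInt_Chasles _ a 1 b), <- (RInt_Chasles _ 1 2 b) in Hy
    by (apply ex_RInt_gamma_integrand; lra).
  unfold plus in Hy; simpl in Hy.
  assert (0 <= RInt (gamma_integrand s) a 1 /\ 0 <= RInt (gamma_integrand s) 2 b).
  { split; (apply RInt_ge_0; [lra|apply ex_RInt_gamma_integrand; lra|
      intros; left; apply gamma_integrand_pos]). }
  apply Rabs_def2 in Hball. lra.
Qed.

(** * Moments of the kernels *)

(* The value of [int_0^oo (c t)^m / (1 + c t)^(b + m) dt]. *)
Fixpoint beta_value (c : R) (m : nat) (b : R) : R :=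
  match m with
  | O => / (c * (b - 1))
  | S m' => (INR m' + 1) / (b + INR m') * beta_value c m' b
  end.

Lemma convex_set_nonneg : convex_set (fun x => 0 <= x).
Proof. intros a b x; lra. Qed.

Lemma p_infty_ge (M : R) : Rbar_locally p_infty (fun x => M <= x).
Proof. exists M. intros x; lra. Qed.

Lemma continuous_beta_integrand (c s : R) (m : nat) (t : R) :
  0 < c -> 0 <= t -> continuous (fun t => (c * t) ^ m / Rpower (1 + c * t) s) t.
Proof.
  intros Hc Ht. apply (ex_derive_continuous (fun t => (c * t) ^ m / Rpower (1 + c * t) s)).
  unfold Rpower. auto_derive. split; [nra|split; [|trivial]].
  apply Rgt_not_eq, exp_pos.
Qed.

Lemma filterlim_Rpower_affine (c r : R) :
  0 < c -> 0 < r ->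
  filterlim (fun t => Rpower (1 + c * t) (- r)) (Rbar_locally p_infty) (locally 0).
Proof.
  intros Hc Hr. unfold Rpower.
  apply (filterlim_ext (fun t => exp (- (r * ln (1 + c * t))))).
  { intros t. now rewrite Ropp_mult_distr_l. }
  apply (filterlim_comp _ _ _ (fun t => ln (1 + c * t)) (fun u => exp (- (r * u)))
    _ (Rbar_locally p_infty)); [|exact (filterlim_exp_opp_scal r Hr)].
  apply (filterlim_comp _ _ _ (fun t => 1 + c * t) ln _ (Rbar_locally p_infty));
    [|exact is_lim_ln_p].
  intros P [M HM]. exists (M / c). intros x Hx. apply HM.
  apply (Rmult_lt_compat_l c) in Hx; [|exact Hc].
  replace (c * (M / c)) with M in Hx by (field; lra). lra.
Qed.

(** From (c t)^m <= (1 + c t)^m; this makes the boundary term at infinity vanish in the integration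
    by parts below. *)
Lemma beta_boundary_le (c r : R) (m : nat) (t : R) :
  0 < c -> 0 <= t ->
  0 <= (c * t) ^ m / Rpower (1 + c * t) (r + INR m) <= Rpower (1 + c * t) (- r).
Proof.
  intros Hc Ht. assert (Hu : 0 < 1 + c * t) by nra.
  assert (Hp : forall y, 0 < Rpower (1 + c * t) y) by (intros; apply exp_pos).
  split; [apply Rdiv_le_0_compat; [apply pow_le; nra|apply Hp]|].
  apply Rle_div_l; [apply Hp|].
  rewrite <- Rpower_plus. replace (- r + (r + INR m)) with (INR m) by ring.
  rewrite Rpower_pow by exact Hu. apply pow_incr. nra.
Qed.

Lemma is_RInt_gen_congr (f g : R -> R) (l l' : R) :
  (forall t, f t = g t) -> l = l' ->
  is_RInt_gen f (at_point 0) (Rbar_locally p_infty) l ->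
  is_RInt_gen g (at_point 0) (Rbar_locally p_infty) l'.
Proof.
  intros H <-. apply is_RInt_gen_ext. apply filter_forall. intros ab t _. apply H.
Qed.

(** Induction on [m]: the derivative of (c t)^(m + 1) / (1 + c t)^(b + m) combines the integrands of
    degrees m and m + 1, and the function vanishes at 0 and at infinity. *)
Lemma is_RInt_gen_beta (c b : R) (m : nat) :
  0 < c -> 1 < b ->
  is_RInt_gen (fun t => (c * t) ^ m / Rpower (1 + c * t) (b + INR m))
    (at_point 0) (Rbar_locally p_infty) (beta_value c m b).
Proof.
  intros Hc Hb. induction m as [|m IH].
  - refine (eq_ind (0 - - / (c * (b - 1))) (is_RInt_gen _ _ _) _ _ _); [|simpl; ring].
    apply (is_RInt_gen_antiderivative _ _ (fun t => 0 <= t)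
      (fun t => - / (c * (b - 1)) * Rpower (1 + c * t) (- (b - 1))));
    [apply convex_set_nonneg|unfold at_point; lra|apply p_infty_ge| | | |].
    + intros t Ht. assert (Hu : 0 < 1 + c * t) by nra.
      unfold Rpower. auto_derive; [exact Hu|].
      replace (b + INR 0) with (b - 1 + 1) by (simpl; ring).
      replace (- (b - 1) * ln (1 + c * t)) with (- ((b - 1) * ln (1 + c * t))) by ring.
      rewrite exp_Ropp, Rmult_plus_distr_r, exp_plus, Rmult_1_l, exp_ln by exact Hu.
      simpl. field. repeat split; try lra. apply Rgt_not_eq, exp_pos.
    + intros t Ht. now apply continuous_beta_integrand.
    + unfold at_point. intros P [eps HP]. apply HP.
      rewrite Rmult_0_r, Rplus_0_r. unfold Rpower. rewrite ln_1, Rmult_0_r, exp_0, Rmult_1_r.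
      apply ball_center.
    + apply filterlim_Rmult_0, filterlim_Rpower_affine; lra.
  - pose proof (pos_INR m) as Hm.
    set (F := fun t => (c * t) ^ S m / Rpower (1 + c * t) (b - 1 + INR (S m))).
    assert (H : is_RInt_gen (fun t => c * (INR m + 1) * ((c * t) ^ m / Rpower (1 + c * t) (b + INR m))
        - c * (b + INR m) * ((c * t) ^ S m / Rpower (1 + c * t) (b + INR (S m))))
      (at_point 0) (Rbar_locally p_infty) (0 - 0)).
    { apply (is_RInt_gen_antiderivative _ _ (fun t => 0 <= t) F);
      [apply convex_set_nonneg|unfold at_point; lra|apply p_infty_ge| | | |].
      - intros t Ht. assert (Hu : 0 < 1 + c * t) by nra.
        unfold F. replace (b - 1 + INR (S m)) with (b + INR m) by (rewrite S_INR; ring).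
        replace (b + INR (S m)) with (b + INR m + 1) by (rewrite S_INR; ring).
        rewrite (Rpower_plus _ 1), Rpower_1 by exact Hu.
        unfold Rpower. auto_derive.
        + repeat split; trivial. apply Rgt_not_eq, exp_pos.
        + change (Init.Nat.pred (S m)) with m.
          change (match m with O => 1 | S _ => INR m + 1 end) with (INR (S m)).
          rewrite S_INR. simpl pow. field.
          split; [lra|apply Rgt_not_eq, exp_pos].
      - intros t Ht.
        apply (continuous_minus (fun t => c * (INR m + 1) * ((c * t) ^ m / Rpower (1 + c * t) (b + INR m)))).
        + apply (continuous_scal_r (c * (INR m + 1)) (fun t => (c * t) ^ m / Rpower (1 + c * t) (b + INR m))).
          now apply continuous_beta_integrand.
        + apply (continuous_scal_r (c * (b + INR m)) (fun t => (c * t) ^ S m / Rpower (1 + c * t) (b + INR (S m)))).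
          now apply continuous_beta_integrand.
      - unfold at_point. intros P [eps HP]. apply HP.
        unfold F. rewrite Rmult_0_r, pow_i by lia. unfold Rdiv; rewrite Rmult_0_l.
        apply ball_center.
      - apply (filterlim_le_le (fun _ => 0) F (fun t => Rpower (1 + c * t) (- (b - 1))) 0).
        + exists 0. intros t Ht. unfold F. apply beta_boundary_le; lra.
        + apply filterlim_const.
        + apply filterlim_Rpower_affine; lra. }
    (* The relation is solved for the integrand of degree m + 1; the boundary value [0 - 0] adds
       nothing. *)
    assert (H1 := is_RInt_gen_minus _ _ _ _
      (is_RInt_gen_scal _ ((INR m + 1) / (b + INR m)) _ IH)
      (is_RInt_gen_scal _ (/ (c * (b + INR m))) _ H)).
    eapply is_RInt_gen_congr; [| |exact H1].
    + intros t.
      unfold minus, plus, opp, scal; simpl; unfold mult; simpl. field.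
      repeat split; try lra; apply Rgt_not_eq, exp_pos.
    + unfold minus, plus, opp, scal; simpl; unfold mult; simpl. ring.
Qed.

(** * Normalisation and moments of the kernels *)

(** For a >= 1 this is a (a + 1) ... (a + k - 1) / k!, with k = v - 1. *)
Definition gamma_quotient (a : R) (k : nat) : R :=
  Gamma (a + INR (S k) - 1) / (Gamma (INR (S k)) * Gamma a).

Lemma gamma_quotient_0 (a : R) : 1 <= a -> gamma_quotient a 0 = 1.
Proof.
  intros Ha. unfold gamma_quotient. simpl INR. rewrite Gamma_1.
  replace (a + 1 - 1) with a by ring. pose proof (Gamma_pos a Ha). field. lra.
Qed.

Lemma gamma_quotient_S (a : R) (k : nat) : 1 <= a ->
  gamma_quotient a (S k) = (a + INR k) / (INR k + 1) * gamma_quotient a k.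
Proof.
  intros Ha. unfold gamma_quotient. pose proof (pos_INR k) as Hk.
  replace (a + INR (S (S k)) - 1) with (a + INR k + 1) by (rewrite !S_INR; ring).
  replace (a + INR (S k) - 1) with (a + INR k) by (rewrite !S_INR; ring).
  rewrite (S_INR (S k)), !Gamma_succ by (rewrite ?S_INR; lra).
  rewrite S_INR.
  pose proof (Gamma_pos a Ha). pose proof (Gamma_pos (INR k + 1) ltac:(lra)).
  field. lra.
Qed.

(** From k to k + 1 the quotient gains (a + k) / (k + 1) and the Beta value its inverse, so the
    product is constant. *)
Lemma kernel_mass_0 (c a : R) (k : nat) : 0 < c -> 3 < a ->
  gamma_quotient a k * beta_value c k a = / (c * (a - 1)).
Proof.
  intros Hc Ha. induction k as [|k IH].
  - rewrite gamma_quotient_0 by lra. simpl. ring.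
  - rewrite gamma_quotient_S by lra. simpl beta_value. rewrite <- IH.
    pose proof (pos_INR k). field. lra.
Qed.

(** Here the growth factors leave (k + 2) / (k + 1), which telescopes. *)
Lemma kernel_mass_1 (c a : R) (k : nat) : 0 < c -> 3 < a ->
  gamma_quotient a k * beta_value c (S k) (a - 1) = (INR k + 1) / (c * (a - 1) * (a - 2)).
Proof.
  intros Hc Ha. induction k as [|k IH].
  - rewrite gamma_quotient_0 by lra. simpl. field. lra.
  - rewrite gamma_quotient_S by lra.
    change (beta_value c (S (S k)) (a - 1))
      with ((INR (S k) + 1) / (a - 1 + INR (S k)) * beta_value c (S k) (a - 1)).
    pose proof (pos_INR k). rewrite !S_INR.
    transitivity ((INR k + 1 + 1) / (INR k + 1)
                  * (gamma_quotient a k * beta_value c (S k) (a - 1))).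
    + field. lra.
    + rewrite IH. field. lra.
Qed.

(** The growth factors leave (k + 3) / (k + 1); a > 3 makes the Beta parameter a - 2 exceed 1. *)
Lemma kernel_mass_2 (c a : R) (k : nat) : 0 < c -> 3 < a ->
  gamma_quotient a k * beta_value c (S (S k)) (a - 2)
  = (INR k + 1) * (INR k + 2) / (c * (a - 1) * (a - 2) * (a - 3)).
Proof.
  intros Hc Ha. induction k as [|k IH].
  - rewrite gamma_quotient_0 by lra. simpl. field. lra.
  - rewrite gamma_quotient_S by lra.
    change (beta_value c (S (S (S k))) (a - 2))
      with ((INR (S (S k)) + 1) / (a - 2 + INR (S (S k))) * beta_value c (S (S k)) (a - 2)).
    pose proof (pos_INR k). rewrite !S_INR.
    transitivity ((INR k + 1 + 1 + 1) / (INR k + 1)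
                  * (gamma_quotient a k * beta_value c (S (S k)) (a - 2))).
    + field. lra.
    + rewrite IH. field. lra.
Qed.

(** Writing t^j = (c t)^j / c^j raises the integer parameter to k + j and lowers the other to n / c
    - j, again a Beta integral. *)
Lemma is_RInt_gen_kernel_power (n : nat) (c : R) (k j : nat) :
  0 < c -> INR j + 1 < INR n / c ->
  is_RInt_gen (fun t => p_kernel n c (S k) t * t ^ j) (at_point 0) (Rbar_locally p_infty)
    (c * gamma_quotient (INR n / c) k / c ^ j * beta_value c (k + j) (INR n / c - INR j)).
Proof.
  intros Hc Ha.
  assert (H := is_RInt_gen_scal (Fa := at_point 0) (Fb := Rbar_locally p_infty) _ (c * gamma_quotient (INR n / c) k / c ^ j) _
    (is_RInt_gen_beta c (INR n / c - INR j) (k + j) Hc ltac:(lra))).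
  eapply is_RInt_gen_congr; [|reflexivity|exact H]. intros t.
  unfold scal; simpl; unfold mult; simpl. unfold p_kernel.
  fold (gamma_quotient (INR n / c) k).
  replace (S k - 1)%nat with k by lia.
  replace (INR n / c + INR (S k) - 1) with (INR n / c - INR j + INR (k + j))
    by (rewrite S_INR, plus_INR; ring).
  rewrite pow_add, (Rpow_mult_distr c t j). field.
  split; [apply Rgt_not_eq, exp_pos|]. apply pow_nonzero; lra.
Qed.

Section Kernel.
Variables (n : nat) (c : R) (k : nat).
Hypotheses (Hc : 0 < c) (Hn : 3 * c < INR n).

Let a_gt_3 : 3 < INR n / c.
Proof. apply Rlt_div_r; lra. Qed.

Lemma is_RInt_gen_kernel_0 :
  is_RInt_gen (p_kernel n c (S k)) (at_point 0) (Rbar_locally p_infty) (c / (INR n - c)).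
Proof.
  eapply is_RInt_gen_congr; [| |apply (is_RInt_gen_kernel_power n c k 0 Hc); simpl; lra].
  - intros t. simpl. ring.
  - simpl. rewrite Nat.add_0_r, Rminus_0_r. unfold Rdiv at 1. rewrite Rinv_1, Rmult_1_r.
    rewrite Rmult_assoc, kernel_mass_0 by (exact Hc || exact a_gt_3). field. lra.
Qed.

Lemma is_RInt_gen_kernel_1 :
  is_RInt_gen (fun t => p_kernel n c (S k) t * t) (at_point 0) (Rbar_locally p_infty)
    (c * (INR k + 1) / ((INR n - c) * (INR n - 2 * c))).
Proof.
  eapply is_RInt_gen_congr; [| |apply (is_RInt_gen_kernel_power n c k 1 Hc); simpl; lra].
  - intros t. simpl. ring.
  - rewrite Nat.add_1_r. simpl INR.
    transitivity (gamma_quotient (INR n / c) k * beta_value c (S k) (INR n / c - 1)).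
    + field. lra.
    + rewrite kernel_mass_1 by (exact Hc || exact a_gt_3). field. lra.
Qed.

Lemma is_RInt_gen_kernel_2 :
  is_RInt_gen (fun t => p_kernel n c (S k) t * t ^ 2) (at_point 0) (Rbar_locally p_infty)
    (c * (INR k + 1) * (INR k + 2)
     / ((INR n - c) * (INR n - 2 * c) * (INR n - 3 * c))).
Proof.
  eapply is_RInt_gen_congr;
    [reflexivity| |apply (is_RInt_gen_kernel_power n c k 2 Hc); simpl; lra].
  replace (k + 2)%nat with (S (S k)) by lia. replace (INR 2) with 2 by (simpl; ring).
  transitivity (/ c * (gamma_quotient (INR n / c) k * beta_value c (S (S k)) (INR n / c - 2))).
  + field. lra.
  + rewrite kernel_mass_2 by (exact Hc || exact a_gt_3). field. lra.
Qed.

(** This integrates the Korovkin majorant. The mass c / (n - c) is factored out because it cancels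
    the prefactor (n - c) / c of the operator. *)
Lemma is_RInt_gen_kernel_quadratic (x e C : R) :
  is_RInt_gen (fun t => p_kernel n c (S k) t * (e + C * (t - x) ^ 2))
    (at_point 0) (Rbar_locally p_infty)
    (c / (INR n - c) *
     (e + C * ((INR k + 1) * (INR k + 2) / ((INR n - 2 * c) * (INR n - 3 * c))
               - 2 * x * ((INR k + 1) / (INR n - 2 * c)) + x ^ 2))).
Proof.
  set (Fb := Rbar_locally p_infty).
  eapply is_RInt_gen_congr; [| |exact (is_RInt_gen_plus (Fa := at_point 0) (Fb := Fb) _ _ _ _
      (is_RInt_gen_scal (Fa := at_point 0) (Fb := Fb) _ (e + C * x ^ 2) _ is_RInt_gen_kernel_0)
    (is_RInt_gen_plus (Fa := at_point 0) (Fb := Fb) _ _ _ _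
      (is_RInt_gen_scal (Fa := at_point 0) (Fb := Fb) _ (- 2 * C * x) _ is_RInt_gen_kernel_1)
      (is_RInt_gen_scal (Fa := at_point 0) (Fb := Fb) _ C _ is_RInt_gen_kernel_2)))].
  - intros t.
    unfold plus, scal; simpl; unfold mult; simpl. ring.
  - unfold plus, scal; simpl; unfold mult; simpl. field. lra.
Qed.

Lemma p_kernel_nonneg (t : R) : 0 <= t -> 0 <= p_kernel n c (S k) t.
Proof.
  intros Ht. pose proof a_gt_3 as Ha. pose proof (pos_INR k). unfold p_kernel.
  assert (0 < Gamma (INR (S k))) by (apply Gamma_pos; rewrite S_INR; lra).
  assert (0 < Gamma (INR n / c)) by (apply Gamma_pos; lra).
  assert (0 < Gamma (INR n / c + INR (S k) - 1)) by (apply Gamma_pos; rewrite S_INR; lra).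
  apply Rmult_le_pos.
  - apply Rmult_le_pos; [lra|]. apply Rdiv_le_0_compat; [lra|]. now apply Rmult_lt_0_compat.
  - apply Rdiv_le_0_compat; [apply pow_le; nra|apply exp_pos].
Qed.

Lemma continuous_p_kernel (t : R) : 0 <= t -> continuous (p_kernel n c (S k)) t.
Proof.
  intros Ht. unfold p_kernel.
  apply (continuous_scal_r (c * (Gamma (INR n / c + INR (S k) - 1) / (Gamma (INR (S k)) * Gamma (INR n / c))))
    (fun t => (c * t) ^ (S k - 1) / Rpower (1 + c * t) (INR n / c + INR (S k) - 1))).
  now apply continuous_beta_integrand.
Qed.
End Kernel.

(** * The Korovkin estimate *)

(* The even extension of [f] trades one-sided continuity at 0 for two-sided continuity. *)
Lemma continuous_comp_Rabs (f : R -> R) :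
  (forall x, 0 <= x -> filterlim f (within (fun y => 0 <= y) (locally x)) (locally (f x))) ->
  forall t, continuous (fun t => f (Rabs t)) t.
Proof.
  intros Hf t.
  apply (filterlim_comp _ _ _ Rabs f _ (within (fun y => 0 <= y) (locally (Rabs t))));
    [|apply Hf, Rabs_pos].
  intros P HP. apply (filter_imp (F := locally t) (fun y => 0 <= Rabs y -> P (Rabs y)));
    [|exact (continuous_Rabs t _ HP)]. intros y Hy. apply Hy, Rabs_pos.
Qed.

(** Multiplied by (n - c) / c the kernel is a probability density, so the deviation from [f x] is at
    most the mean of the quadratic majorant. *)
Lemma kernel_integral_estimate (n : nat) (c : R) (k : nat) (f : R -> R) (x e C : R) :
  0 < c -> 3 * c < INR n ->
  (forall t, continuous (fun t => f (Rabs t)) t) ->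
  (forall t, 0 <= t -> Rabs (f t - f x) <= e + C * (t - x) ^ 2) ->
  Rabs ((INR n - c) / c *
    RInt_gen (fun t => p_kernel n c (S k) t * f t) (at_point 0) (Rbar_locally p_infty) - f x)
  <= e + C * ((INR k + 1) * (INR k + 2) / ((INR n - 2 * c) * (INR n - 3 * c))
               - 2 * x * ((INR k + 1) / (INR n - 2 * c)) + x ^ 2).
Proof.
  intros Hc Hn Hcont Hf.
  set (h := fun t => p_kernel n c (S k) t * (f t - f x)).
  set (g := fun t => p_kernel n c (S k) t * (e + C * (t - x) ^ 2)).
  pose proof (is_RInt_gen_kernel_quadratic n c k Hc Hn x e C) as Hg. fold g in Hg.
  assert (Hle : forall t, 0 <= t -> Rabs (h t) <= g t).
  { intros t Ht. unfold h, g.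
    pose proof (p_kernel_nonneg n c k Hc Hn t Ht).
    rewrite Rabs_mult, (Rabs_pos_eq (p_kernel _ _ _ _)) by assumption.
    now apply Rmult_le_compat_l; [|apply Hf]. }
  assert (Hex : ex_RInt_gen h (at_point 0) (Rbar_locally p_infty)).
  { apply (ex_RInt_gen_dominated _ _ (fun t => 0 <= t) h g);
      [apply convex_set_nonneg|unfold at_point; lra|apply p_infty_ge| | |exact Hle
      |now eexists; exact Hg].
    - intros a b Ha Hb.
      (* On t >= 0 the even extension agrees with [f], and it is continuous in the two-sided sense
         that integrability requires. *)
      apply (ex_RInt_ext (fun t => p_kernel n c (S k) t * (f (Rabs t) - f x))).
      + intros t Ht. unfold h. rewrite Rabs_pos_eq; [easy|].
        apply (convex_set_Rmin _ a b t convex_set_nonneg); auto; lra.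
      + apply (ex_RInt_continuous (fun t => p_kernel n c (S k) t * (f (Rabs t) - f x))).
        intros t Ht.
        pose proof (convex_set_Rmin _ a b t convex_set_nonneg Ha Hb Ht) as Ht0.
        apply (continuous_mult (p_kernel n c (S k)) (fun t => f (Rabs t) - f x));
          [now apply continuous_p_kernel|].
        apply (continuous_minus (fun t => f (Rabs t))); [apply Hcont|apply continuous_const].
    - intros a b Ha Hb. apply (ex_RInt_continuous g). intros t Ht.
      pose proof (convex_set_Rmin _ a b t convex_set_nonneg Ha Hb Ht) as Ht0.
      apply (continuous_mult (p_kernel n c (S k)) (fun t => e + C * (t - x) ^ 2));
        [now apply continuous_p_kernel|].
      apply (ex_derive_continuous (fun t => e + C * (t - x) ^ 2)). auto_derive; auto. }
  destruct Hex as [l Hl].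
  assert (Hll : Rabs l <= c / (INR n - c) *
     (e + C * ((INR k + 1) * (INR k + 2) / ((INR n - 2 * c) * (INR n - 3 * c))
               - 2 * x * ((INR k + 1) / (INR n - 2 * c)) + x ^ 2))).
  { apply (RInt_gen_norm (V := R_CompleteNormedModule) (Fa := at_point 0)
      (Fb := Rbar_locally p_infty) h g); [| |exact Hl|exact Hg].
    - exists (fun a => a = 0) (fun b => 0 <= b); [reflexivity|apply p_infty_ge|].
      simpl. intros a b -> Hb. exact Hb.
    - exists (fun a => a = 0) (fun b => 0 <= b); [reflexivity|apply p_infty_ge|].
      simpl. intros a b -> Hb t Ht. apply Hle. lra. }
  (* Splitting f = (f - f x) + f x gives the integral as [l] plus [f x] times the mass of the
     kernel. *)
  rewrite (is_RInt_gen_unique (V := R_CompleteNormedModule)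
    (fun t => p_kernel n c (S k) t * f t) (l + f x * (c / (INR n - c)))).
  - replace ((INR n - c) / c * (l + f x * (c / (INR n - c))) - f x)
      with ((INR n - c) / c * l) by (field; lra).
    assert (Hp : 0 < (INR n - c) / c) by (apply Rdiv_lt_0_compat; lra).
    rewrite Rabs_mult, (Rabs_pos_eq _ (Rlt_le _ _ Hp)).
    apply (Rmult_le_compat_l _ _ _ (Rlt_le _ _ Hp)) in Hll.
    eapply Rle_trans; [exact Hll|]. right. rewrite <- Rmult_assoc.
    replace ((INR n - c) / c * (c / (INR n - c))) with 1 by (field; lra). ring.
  - eapply is_RInt_gen_congr; [| |exact (is_RInt_gen_plus (Fa := at_point 0)
      (Fb := Rbar_locally p_infty) _ _ _ _ Hl
      (is_RInt_gen_scal (Fa := at_point 0) (Fb := Rbar_locally p_infty) _ (f x) _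
        (is_RInt_gen_kernel_0 n c k Hc Hn)))].
    + intros t. unfold plus, scal; simpl; unfold mult; simpl. unfold h. ring.
    + reflexivity.
Qed.

(** The weights and the atom at 0 have total mass 1, so the pointwise majorant can be averaged; its
    mean is computed from the three moment sums. *)
Lemma Dstar_estimate (n : nat) (c b : R) (f : R -> R) (x e C : R) :
  0 < c -> 3 * c < INR n -> 0 <= b -> b <= 1 / 8 -> 0 <= x ->
  (forall t, continuous (fun t => f (Rabs t)) t) ->
  (forall t, 0 <= t -> Rabs (f t - f x) <= e + C * (t - x) ^ 2) ->
  Rabs (Dstar n c b f x - f x)
  <= e + C * ((c * x ^ 2 + x * (1 + / (1 - b) ^ 2)) / (INR n - 3 * c)).
Proof.
  intros Hc Hn Hb0 Hb Hx Hcont Hf.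
  set (N := INR n) in *.
  (* With this [z] the first moment z / (1 - b) divided by n - 2c is exactly x, so the operator
     fixes t. *)
  set (z := (N - 2 * c) * (1 - b) * x).
  assert (Hz : 0 <= z) by (unfold z; apply Rmult_le_pos; [apply Rmult_le_pos|]; lra).
  assert (Ez : N * r_n n c b x = z) by (unfold r_n, z; fold N; field; lra).
  unfold Dstar. fold N. cbv zeta. rewrite Ez.
  set (w := fun k => omega b (S k) z).
  set (I := fun k => (N - c) / c *
    RInt_gen (fun t => p_kernel n c (S k) t * f t) (at_point 0) (Rbar_locally p_infty)).
  set (g := fun k => e + C * ((INR k + 1) * (INR k + 2) / ((N - 2 * c) * (N - 3 * c))
               - 2 * x * ((INR k + 1) / (N - 2 * c)) + x ^ 2)).
  assert (HI : forall k, Rabs (I k - f x) <= g k)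
    by (intros k; now apply kernel_integral_estimate).
  assert (Hw : forall k, 0 <= w k) by (intros k; now apply omega_nonneg).
  pose proof (is_series_omega b z Hb0 Hb Hz) as S0. fold w in S0.
  pose proof (is_series_omega_1 b z Hb0 Hb Hz) as S1.
  pose proof (is_series_omega_2 b z Hb0 Hb Hz) as S2.
  assert (HG : is_series (fun k => w k * g k)
    (e * (1 - exp (- z)) + C * ((x ^ 2 + (c * x ^ 2 + x * (1 + / (1 - b) ^ 2)) / (N - 3 * c))
       - 2 * x ^ 2 + x ^ 2 * (1 - exp (- z))))).
  (* The coefficients come from (k + 1)(k + 2) = (k + 1) k + 2 (k + 1). *)
  { pose proof (is_series_plus _ _ _ _ (is_series_scal_l (e + C * x ^ 2) _ _ S0)
      (is_series_plus _ _ _ _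
        (is_series_scal_l (C * (2 / ((N - 2 * c) * (N - 3 * c)) - 2 * x / (N - 2 * c))) _ _ S1)
        (is_series_scal_l (C / ((N - 2 * c) * (N - 3 * c))) _ _ S2))) as H.
    match type of H with is_series _ ?l => replace l with
      (e * (1 - exp (- z)) + C * ((x ^ 2 + (c * x ^ 2 + x * (1 + / (1 - b) ^ 2)) / (N - 3 * c))
       - 2 * x ^ 2 + x ^ 2 * (1 - exp (- z)))) in H end.
    - eapply is_series_ext; [|exact H]. intros k.
      unfold plus, scal; simpl; unfold mult; simpl. unfold g. fold (w k). field. lra.
    - unfold plus, scal; simpl; unfold mult; simpl. unfold z. field. lra. }
  assert (Hle : forall k, Rabs (w k * (I k - f x)) <= w k * g k).
  { intros k. rewrite Rabs_mult, (Rabs_pos_eq _ (Hw k)). now apply Rmult_le_compat_l. }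
  assert (Habs : ex_series (fun k => Rabs (w k * (I k - f x)))).
  { apply (ex_series_le (fun k => Rabs (w k * (I k - f x))) (fun k => w k * g k));
      [|eexists; exact HG].
    intros k. unfold norm; simpl; unfold abs; simpl. rewrite Rabs_Rabsolu. apply Hle. }
  assert (Hdiff : Rabs (Series (fun k => w k * (I k - f x))) <= Series (fun k => w k * g k)).
  { eapply Rle_trans; [now apply Series_Rabs|].
    apply Series_le; [|eexists; exact HG]. intros k; split; [apply Rabs_pos|apply Hle]. }
  rewrite (is_series_unique _ _ HG) in Hdiff.
  pose proof (Series_correct _ (ex_series_Rabs _ Habs)) as HD.
  assert (HIs : Series (fun k => w k * I k)
    = Series (fun k => w k * (I k - f x)) + f x * (1 - exp (- z))).
  { apply is_series_unique.
    eapply is_series_ext; [|exact (is_series_plus _ _ _ _ HD (is_series_scal_l (f x) _ _ S0))].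
    intros k. unfold plus, scal; simpl; unfold mult; simpl. ring. }
  rewrite <- Series_scal_l.
  rewrite (Series_ext _ (fun k => w k * I k)) by (intros k; unfold w, I; ring).
  rewrite HIs.
  replace (Series (fun k => w k * (I k - f x)) + f x * (1 - exp (- z)) + exp (- z) * f 0 - f x)
    with (Series (fun k => w k * (I k - f x)) + exp (- z) * (f 0 - f x)) by ring.
  eapply Rle_trans; [apply Rabs_triang|].
  (* The majorant at t = 0, weighted by [exp (- z)], supplies what the series lacks: the sum becomes
     [e] plus [C] times the second central moment. *)
  assert (H0 : Rabs (exp (- z) * (f 0 - f x)) <= exp (- z) * (e + C * x ^ 2)).
  { pose proof (exp_pos (- z)) as He.
    rewrite Rabs_mult, (Rabs_pos_eq _ (Rlt_le _ _ He)).
    apply Rmult_le_compat_l; [lra|]. replace (x ^ 2) with ((0 - x) ^ 2) by ring.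
    apply Hf; lra. }
  lra.
Qed.

(** Close to x uniform continuity gives [e]; at distance at least r the quadratic growth of [f] is
    absorbed by a multiple of (t - x)^2. *)
Lemma korovkin_modulus (f : R -> R) (K M e : R) :
  (forall t, continuous (fun t => f (Rabs t)) t) ->
  (forall x, 0 <= x -> Rabs (f x) <= M * (1 + x ^ 2)) -> 0 <= K -> 0 < e ->
  exists C, 0 <= C /\ forall x t, 0 <= x <= K -> 0 <= t ->
    Rabs (f t - f x) <= e + C * (t - x) ^ 2.
Proof.
  intros Hcont HM HK He.
  assert (HM0 : 0 <= M).
  { specialize (HM 0 (Rle_refl _)). pose proof (Rabs_pos (f 0)). lra. }
  (* The interval reaches to K + 1 so that it contains every t within distance r <= 1 of a point of
     [0, K]. *)
  destruct (Heine (fun t => f (Rabs t)) _ (compact_P3 0 (K + 1))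
    (fun t _ => proj2 (continuity_pt_filterlim _ t) (Hcont t)) (mkposreal e He))
    as [d Hd]. simpl in Hd.
  set (r := Rmin d 1).
  assert (Hr : 0 < r) by (apply Rmin_pos; [apply cond_pos|lra]).
  assert (Hrd : r <= d) by apply Rmin_l.
  assert (Hr1 : r <= 1) by apply Rmin_r.
  (* Far from x the difference is at most M (2 + 3 K^2 + 2 (t - x)^2), and the constant part is
     multiplied by (t - x)^2 / r^2 >= 1. *)
  exists (M * ((2 + 3 * K ^ 2) / r ^ 2 + 2)).
  assert (Hr2 : 0 < r ^ 2) by now apply pow_lt.
  assert (Hq : 0 <= (2 + 3 * K ^ 2) / r ^ 2)
    by (apply Rdiv_le_0_compat; [pose proof (pow2_ge_0 K); lra|exact Hr2]).
  split; [apply Rmult_le_pos; lra|].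
  intros x t Hx Ht. pose proof (pow2_ge_0 (t - x)) as Hsq.
  destruct (Rlt_le_dec (Rabs (t - x)) r) as [Hlt|Hge].
  - assert (Rabs (f t - f x) < e).
    { specialize (Hd t x). rewrite !(Rabs_pos_eq t), !(Rabs_pos_eq x) in Hd by lra.
      apply Hd; [|lra|lra]. pose proof (Rabs_def2 _ _ Hlt). lra. }
    assert (0 <= M * ((2 + 3 * K ^ 2) / r ^ 2 + 2) * (t - x) ^ 2); [|lra].
    apply Rmult_le_pos; [apply Rmult_le_pos; lra|exact Hsq].
  - assert (H1 : r ^ 2 <= (t - x) ^ 2) by (rewrite <- (pow2_abs (t - x)); apply pow_incr; lra).
    assert (H2 : 2 + 3 * K ^ 2 <= (2 + 3 * K ^ 2) / r ^ 2 * (t - x) ^ 2).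
    { replace (2 + 3 * K ^ 2) with ((2 + 3 * K ^ 2) / r ^ 2 * r ^ 2) at 1 by (field; lra).
      now apply Rmult_le_compat_l. }
    assert (H3 : Rabs (f t - f x) <= M * (2 + t ^ 2 + x ^ 2)).
    { unfold Rminus. eapply Rle_trans; [apply Rabs_triang|]. rewrite Rabs_Ropp.
      pose proof (HM t Ht). pose proof (HM x (proj1 Hx)). lra. }
    assert (H4 : 2 + t ^ 2 + x ^ 2 <= 2 + 3 * K ^ 2 + 2 * (t - x) ^ 2).
    { assert (x ^ 2 <= K ^ 2) by (apply pow_incr; lra).
      (* This square is 2 (t - x)^2 + 2 x^2 - t^2. *)
      pose proof (pow2_ge_0 (t - 2 * x)). lra. }
    apply (Rmult_le_compat_l M) in H4; [|exact HM0].
    apply (Rmult_le_compat_l M) in H2; [|exact HM0]. lra.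
Qed.

Theorem theorem6 (c : R) (beta : nat -> R) :
  0 < c ->
  (forall n, 0 <= beta n < 1) ->
  is_lim_seq beta 0 ->
  forall (B : R -> Prop) (f : R -> R),
    compact B -> (forall x, B x -> 0 <= x) ->
    C_rho0 f ->
    forall eps : R, 0 < eps ->
      exists N : nat, forall n : nat, (N <= n)%nat -> 3 * c < INR n ->
        forall x, B x -> Rabs (Dstar n c (beta n) f x - f x) < eps.
Proof.
  intros Hc Hbeta Hlim B f HB HB0 [Hf [[M HM] _]] eps Heps.
  pose proof (continuous_comp_Rabs f Hf) as Hcont.
  destruct (compact_P1 B HB) as [m [K0 HK0]].
  (* The maximum keeps [K] nonnegative even if [B] is empty. *)
  set (K := Rmax K0 0).
  assert (HK : forall x, B x -> 0 <= x <= K).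
  { intros x Bx. split; [now apply HB0|].
    eapply Rle_trans; [apply (HK0 x Bx)|apply Rmax_l]. }
  assert (HK1 : 0 <= K) by apply Rmax_r.
  destruct (korovkin_modulus f K M (eps / 2) Hcont HM HK1 ltac:(lra)) as [C [HC HCf]].
  apply is_lim_seq_spec in Hlim.
  destruct (Hlim (mkposreal (1 / 8) ltac:(lra))) as [N1 HN1]. simpl in HN1.
  (* For b <= 1/8 one has 1 / (1 - b)^2 <= 2, so [A] bounds [C] times the numerator on [0, K].
     Choosing n > 3c + 2A / eps makes A / (n - 3c) less than eps / 2. *)
  set (A := C * (c * K ^ 2 + 3 * K)).
  destruct (INR_unbounded (3 * c + 2 * A / eps)) as [N2 HN2].
  exists (Nat.max N1 N2). intros n Hn Hnc x Bx.
  destruct (HK x Bx) as [Hx0 HxK]. destruct (Hbeta n) as [Hb0 _].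
  assert (Hb : beta n <= 1 / 8).
  { specialize (HN1 n ltac:(lia)). apply Rabs_def2 in HN1. lra. }
  eapply Rle_lt_trans.
  { apply (Dstar_estimate n c (beta n) f x (eps / 2) C); auto. }
  assert (HnN : INR N2 <= INR n) by (apply le_INR; lia).
  assert (Hinv : / (1 - beta n) ^ 2 <= 2).
  { replace 2 with (/ / 2) by field. apply Rinv_le_contravar; [lra|]. nra. }
  assert (Hnum : c * x ^ 2 + x * (1 + / (1 - beta n) ^ 2) <= c * K ^ 2 + 3 * K).
  { assert (x ^ 2 <= K ^ 2) by (apply pow_incr; lra). nra. }
  assert (Hlt : A < eps / 2 * (INR n - 3 * c)).
  { replace A with (eps / 2 * (2 * A / eps)) by (field; lra).
    apply Rmult_lt_compat_l; lra. }
  assert (Hfin : C * ((c * x ^ 2 + x * (1 + / (1 - beta n) ^ 2)) / (INR n - 3 * c)) < eps / 2).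
  { unfold Rdiv at 1. rewrite <- Rmult_assoc.
    apply Rlt_div_l; [lra|]. eapply Rle_lt_trans; [|exact Hlt].
    now apply Rmult_le_compat_l. }
  lra.
Qed.
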